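(* Let $t\geq 1$ and $k\geq 2$ be integers, and let $G$ be a $t$-connected graph of order $n\geq (k-2)t+4$. If $q(\overline{G})\leq n+(k-2)t$ and $G\notin\mathbb{G}_3(n,k,t)$, then $G$ has a spanning $k$-tree.
   Context: All graphs are finite, simple and undirected. $\overline{G}$ is the complement of $G$, and $q(\cdot)$ is the largest eigenvalue of the signless Laplacian matrix $Q=D+A$ (degree diagonal matrix plus adjacency matrix). A graph is $t$-connected if it has more than $t$ vertices and remains connected whenever fewer than $t$ vertices are removed. A spanning $k$-tree of $G$ is a spanning tree of $G$ with maximum degree at most $k$. $\vee$ denotes join, and $R(m,s)$ denotes an (arbitrary) $s$-regular graph of order $m$. $\mathcal{G}_r$ denotes the set of all graphs of order $r\geq 0$ (for $r=0$ the null graph, joining with which leaves a graph unchanged). When $\frac{n-(k-2)t-2}{2}$ is an integer, $\mathbb{G}_3(n,k,t)=\{G_r\vee R(n-r,\frac{n-(k-2)t-2}{2}-r) : 0\leq r\leq \frac{n-(k-2)t-2}{2},\ G_r\in\mathcal{G}_r\}$ (with any regular graph of the indicated order and degree); in particular for $r=0$ this is $R(n,\frac{n-(k-2)t-2}{2})$. When $\frac{n-(k-2)t-2}{2}$ is not an integer, $\mathbb{G}_3(n,k,t)$ is empty. *)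

(* Defs.v *)
From mathcomp Require Import all_boot all_order all_algebra.
From mathcomp Require Import reals.

Set Implicit Arguments.
Unset Strict Implicit.
Unset Printing Implicit Defensive.

Import Order.TTheory GRing.Theory Num.Theory.

Record sgraph (T : finType) := SGraph {
  adj :> rel T;
  adj_sym : symmetric adj;
  adj_irr : irreflexive adj }.

Definition deg (T : finType) (G : sgraph T) (x : T) : nat := #|[set y | G x y]|.

Definition regular (T : finType) (G : sgraph T) (s : nat) : Prop :=
  forall x, deg G x = s.

Definition isomorphic (T1 T2 : finType) (G1 : sgraph T1) (G2 : sgraph T2) : Prop :=
  exists2 f : T1 -> T2, bijective f & forall x y, G2 (f x) (f y) = G1 x y.

Section Complement.
Variables (T : finType) (G : sgraph T).

Definition compl_rel : rel T := fun x y => (x != y) && ~~ G x y.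

Lemma compl_sym : symmetric compl_rel.
Proof. by move=> x y; rewrite /compl_rel eq_sym adj_sym. Qed.

Lemma compl_irr : irreflexive compl_rel.
Proof. by move=> x; rewrite /compl_rel eqxx. Qed.

Definition compl : sgraph T := SGraph compl_sym compl_irr.

End Complement.

Section Join.
Variables (T1 T2 : finType) (G1 : sgraph T1) (G2 : sgraph T2).

Definition join_rel : rel (T1 + T2) := fun u v =>
  match u, v with
  | inl x, inl y => G1 x y
  | inr x, inr y => G2 x y
  | _, _ => true
  end.

Lemma join_sym : symmetric join_rel.
Proof. by move=> [x|x] [y|y] //=; rewrite adj_sym. Qed.

Lemma join_irr : irreflexive join_rel.
Proof. by move=> [x|x] /=; rewrite adj_irr. Qed.

Definition join : sgraph (T1 + T2)%type := SGraph join_sym join_irr.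

End Join.

Section Induced.
Variables (T : finType) (G : sgraph T) (A : {set T}).

Definition induced_rel : rel {x : T | x \in A} := fun x y => G (val x) (val y).

Lemma induced_sym : symmetric induced_rel.
Proof. by move=> x y; rewrite /induced_rel adj_sym. Qed.

Lemma induced_irr : irreflexive induced_rel.
Proof. by move=> x; rewrite /induced_rel adj_irr. Qed.

Definition induced : sgraph {x : T | x \in A} := SGraph induced_sym induced_irr.

End Induced.

Definition connected (T : finType) (G : sgraph T) : Prop :=
  0 < #|T| /\ forall x y, connect G x y.

Definition t_connected (t : nat) (T : finType) (G : sgraph T) : Prop :=
  t < #|T| /\ forall S : {set T}, #|S| < t -> connected (induced G (~: S)).

(* The bound on the length excludes the closed walks [:: x] and [:: x; y]. *)
Definition acyclic (T : finType) (G : sgraph T) : Prop :=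
  forall c : seq T, 2 < size c -> ~ ucycle G c.

Definition is_tree (T : finType) (G : sgraph T) : Prop :=
  connected G /\ acyclic G.

Definition has_spanning_ktree (k : nat) (T : finType) (G : sgraph T) : Prop :=
  exists F : sgraph T,
    [/\ subrel F G, is_tree F & forall x, deg F x <= k].

(* No truncated subtraction is used for (n - (k-2)t - 2)/2: it is the number m
   with n = (k-2)t + 2 + 2m, and if no such natural number exists then the
   quotient is not an integer or no r satisfies 0 <= r <= m. *)
Definition in_G3 (n k t : nat) (T : finType) (G : sgraph T) : Prop :=
  exists m r : nat, [/\ n = (k - 2) * t + 2 + m.*2, r <= m &
    exists (Gr : sgraph 'I_r) (H : sgraph 'I_(n - r)),
      regular H (m - r) /\ isomorphic G (join Gr H)].

Local Open Scope ring_scope.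

Section SignlessLaplacian.
Variables (R : realType) (T : finType) (G : sgraph T).

Definition degree_mx : 'M[R]_#|T| :=
  diag_mx (\row_i (deg G (enum_val i))%:R).

Definition adjacency_mx : 'M[R]_#|T| :=
  \matrix_(i, j) (G (enum_val i) (enum_val j))%:R.

Definition signless_laplacian : 'M[R]_#|T| := degree_mx + adjacency_mx.

End SignlessLaplacian.

Definition largest_eigenvalue (R : realType) (n : nat) (A : 'M[R]_n) (q : R) : Prop :=
  eigenvalue A q /\ forall a : R, eigenvalue A a -> a <= q.

(* Main.v *)
Require Import Defs.
From mathcomp Require Import all_boot all_order all_algebra.
From mathcomp Require Import reals complex spectral boolp sesquilinear ring zify.

(** Suppose G has no spanning k-tree; dropping acyclicity, this means no
    connected spanning subgraph of maximum degree at most k.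

    Closure.  Let u, v be nonadjacent and let G + uv have such a subgraph but
    not G.  A breadth-first tree of it uses uv, and deleting uv leaves two
    branches rooted at u and v.  Call a vertex x of a branch with root a
    saturated if x <> a has k - 1 children, none adjacent to a in G.  An
    unsaturated vertex can be brought to degree less than k, by rehanging one of
    its children on a if needed; hence every edge of G between the branches
    has a saturated end, and t-connectedness gives at least t saturated
    vertices.  Counting children, which are nonneighbours of the root, yields
    d(u) + d(v) <= n - 2 - (k-2)t.

    Spectrum.  Take an edge-maximal G' above G without such a subgraph and let
    H be its complement.  Every edge uv of H has d_H(u) + d_H(v) >= c where
    c = n + (k-2)t.  For x = d_H, the quadratic form of the signless Laplacian of
    the complement of G is at least the sum of (x_u + x_v)^2 over the edges
    of H, hence at least c |x|^2; since q <= c all these are equalities.  So the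
    nonisolated part of H is a union of components of the complement of G on
    which degree sums along edges equal c, and as G is connected this part is
    regular of degree c/2, which puts G in G_3. *)

Set Implicit Arguments.
Unset Strict Implicit.
Unset Printing Implicit Defensive.

Import Order.TTheory GRing.Theory Num.Theory.

(** * Connected subgraphs of bounded degree and their breadth-first trees *)

Definition has_connected_kgraph (k : nat) (T : finType) (G : sgraph T) : Prop :=
  exists F : sgraph T,
    [/\ subrel F G, connected F & forall x, deg F x <= k].

Section ParentGraph.
Variables (T : finType) (C : {set T}) (a : T) (p : T -> T).

Definition parent_rel : rel T := fun x y =>
  (x != y) && ([&& x \in C, x != a & p x == y] || [&& y \in C, y != a & p y == x]).

Lemma parent_sym : symmetric parent_rel.
Proof. by move=> x y; rewrite /parent_rel eq_sym orbC. Qed.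

Lemma parent_irr : irreflexive parent_rel.
Proof. by move=> x; rewrite /parent_rel eqxx. Qed.

Definition parent_graph : sgraph T := SGraph parent_sym parent_irr.

Definition children x := [set z in C | (z != a) && (p z == x)].

Lemma deg_parent_graph x :
  deg parent_graph x <= #|children x| + ((x \in C) && (x != a)).
Proof.
rewrite /deg; case xC: ((x \in C) && (x != a)) => /=.
  apply: (@leq_trans #|p x |: children x|); last first.
    by rewrite cardsU1 addnC leq_add2l leq_b1.
  apply/subset_leq_card/subsetP => y; rewrite !inE /= /parent_rel.
  case/andP=> _ /orP[/and3P[_ _ /eqP->]|/and3P[-> -> ->]]; rewrite ?eqxx ?orbT //.
rewrite addn0; apply/subset_leq_card/subsetP => y; rewrite !inE /= /parent_rel.
case/andP=> _ /orP[/and3P[h1 h2 _]|/and3P[-> -> ->]] //.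
by rewrite h1 h2 in xC.
Qed.

(** Descent on [d] ends at the root. The alternative [p z = a] lets a vertex be rehung on the root
    without any comparison of values of [d]. *)
Lemma connect_parent_graph (d : T -> nat) x :
  (forall z, z \in C -> z != a ->
     p z \in C /\ (p z = a \/ d (p z) < d z)) ->
  x \in C -> connect parent_graph x a.
Proof.
move=> pC; have [m] := ubnP (d x); elim: m x => // m IH x; rewrite ltnS => le_dm xC.
have [->|xa] := eqVneq x a; first exact: connect0.
have [pxC dp] := pC x xC xa.
have xp : connect parent_graph x (p x).
  have [<-|npx] := eqVneq x (p x); first exact: connect0.
  by apply: connect1; rewrite /= /parent_rel npx xC xa eqxx.
case: dp => [<- //|dp]; apply: connect_trans xp (IH _ _ pxC).
exact: leq_trans dp le_dm.
Qed.

End ParentGraph.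

Lemma connect_symG (T : finType) (G : sgraph T) x y : connect G x y = connect G y x.
Proof. by apply: sym_connect_sym; exact: adj_sym. Qed.

(** [d] is the distance to [r], and [p] takes the first step of a shortest walk to [r]. *)
Lemma distance_parent (T : finType) (G : sgraph T) (r : T) :
  connected G -> exists (d : T -> nat) (p : T -> T),
    forall z, z != r -> G z (p z) /\ d (p z) < d z.
Proof.
case=> _ connG.
have ex z : exists n, [exists t : n.-tuple T, path G z t && (last z t == r)].
  have /connectP[t pt lt] := connG z r; exists (size t).
  by apply/existsP; exists (in_tuple t); rewrite pt /= -lt eqxx.
pose d z := ex_minn (ex z).
have dle z t : path G z t -> last z t = r -> d z <= size t.
  move=> pt lt; rewrite /d; case: ex_minnP => m _; apply; apply/existsP.
  by exists (in_tuple t); rewrite pt /= lt eqxx.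
have next z : exists y, z != r -> G z y /\ d y < d z.
  have [->|zr] := eqVneq z r; first by exists r.
  suff [y Hy] : exists y, G z y /\ d y < d z by exists y.
  rewrite [d z]/d; case: ex_minnP => m /existsP[[[|y t] /= st]].
    by rewrite (negbTE zr).
  case/andP=> /andP[zy pt] /eqP lt _; exists y; split=> //.
  by rewrite -(eqP st) ltnS; apply: dle.
have [p Hp] := fin_all_exists next.
by exists d, p.
Qed.

(** The parent edges of a breadth-first search form the tree. On a cycle, both neighbours of a
    vertex farthest from the root would have to be its parent. *)
Lemma connected_kgraph_spanning_ktree k (T : finType) (G : sgraph T) :
  has_connected_kgraph k G -> has_spanning_ktree k G.
Proof.
case=> F [sFG connF degF].
have [/card_gt0P[r _] _] := connF.
have [d [p Hp]] := distance_parent r connF.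
pose S := parent_graph [set: T] r p.
have sSF : subrel S F.
  move=> x y /andP[_ /orP[]/and3P[_ /Hp[Fx _] /eqP <-] //].
  by rewrite adj_sym.
exists S; split; first by move=> x y /sSF/sFG.
- split; first split=> [|x y]; first by case: connF.
    have toR z : connect S z r.
      apply: (connect_parent_graph (d := d)); last by rewrite inE.
      by move=> w _ /Hp[_ dw]; rewrite inE; split=> //; right.
    by apply: connect_trans (toR x) _; rewrite connect_symG.
  move=> c szc uc.
  have [x0 x0c] : exists x, x \in c by case: c szc {uc} => // x c _; exists x; rewrite mem_head.
  pose z := [arg max_(w > x0 in mem c) d w].
  have [zc zmax] : z \in c /\ forall w, w \in c -> d w <= d z.
    by rewrite /z; case: arg_maxnP.
  have down y : S z y -> y \in c -> y = p z.
    move=> /andP[_ /orP[/and3P[_ _ /eqP//]|/and3P[_ /Hp[_ dy] /eqP pyz]]] /zmax.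
    by rewrite leqNgt -pyz dy.
  have [i c' defc] := rot_to zc.
  have : ucycle S (rot i c) by rewrite rot_ucycle.
  have memc w : w \in z :: c' -> w \in c by rewrite -defc mem_rot.
  have : 2 < size (z :: c') by rewrite -defc size_rot.
  rewrite defc; case: c' memc {defc} => [|y [|y' c']] // memc _.
  case/andP=> /= /and3P[zy _]; rewrite rcons_path => /andP[_ lz] /and3P[_ yc' _].
  have ey : y = p z by apply: down => //; apply: memc; rewrite !inE eqxx orbT.
  have el : last y' c' = p z.
    apply: down; first by rewrite adj_sym.
    by apply: memc; rewrite 2!in_cons mem_last !orbT.
  by move: yc'; rewrite ey -el mem_last.
- move=> x; apply: leq_trans (degF x); apply/subset_leq_card/subsetP => y.
  by rewrite !inE => /sSF.
Qed.

(** * Branches of a rooted tree and their saturated vertices *)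

Section Branch.
Variables (k : nat) (T : finType) (G : sgraph T) (C : {set T}) (a : T).
Variables (p : T -> T) (d : T -> nat).
Hypothesis aC : a \in C.
Hypothesis pC : forall z, z \in C -> z != a ->
  [/\ p z \in C, G z (p z) & d (p z) < d z].
Hypothesis ch_lt : forall x, #|children C a p x| < k.

(* The vertices of full degree that cannot be relieved of a child by hanging
   that child on the root. *)
Definition saturated := [set x in C | [&& x != a, #|children C a p x| == k.-1 &
  [forall c in children C a p x, ~~ G a c]]].

(** The children of the saturated vertices form disjoint sets of size [k.-1], none meeting the
    neighbourhood of [a]. The inequality is strict because [a] lies in [C] but is neither a child
    nor its own neighbour. *)
Lemma card_saturated_lt : #|[set y in C | G a y]| + k.-1 * #|saturated| < #|C|.
Proof.
pose D := [set c in C | (c != a) && (p c \in saturated)].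
have <- : #|D| = k.-1 * #|saturated|.
  rewrite -sum1_card (partition_big p (mem saturated)) => [|c]; last first.
    by rewrite inE => /and3P[].
  rewrite mulnC -sum_nat_const; apply: eq_bigr => x xL.
  have xS : x \in saturated by []; have := xS; rewrite inE => /and4P[_ _ /eqP <- _].
  rewrite -sum1_card; apply: eq_bigl => c; apply/andP/idP.
    by case=> [] cD /eqP <-; move: cD; rewrite !inE eqxx => /and3P[-> ->].
  by rewrite inE => /and3P[cC ca /eqP pcx]; rewrite pcx eqxx inE cC ca pcx xS.
have disj : [disjoint [set y in C | G a y] & D].
  rewrite disjoint_subset; apply/subsetP => c; rewrite inE => /andP[cC Gac].
  apply/negP; rewrite inE => /and3P[_ ca]; rewrite inE => /and4P[_ _ _].
  by move=> /forall_inP/(_ c); rewrite Gac inE cC ca eqxx => /(_ isT).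
rewrite -cardsUI (disjoint_setI0 disj) cards0 addn0.
apply: proper_card; apply/properP; split.
  by apply/subsetP => c; rewrite !inE => /orP[]/andP[].
by exists a => //; rewrite !inE adj_irr eqxx !andbF.
Qed.

(** [D] keeps a free slot at [x] for an edge leaving the branch. Either [x] is the root, or it has
    at most [k - 2] children, or it has a child [c] adjacent to [a], and then [c] moves to [a]. *)
Lemma unsaturated_branch x : 1 < k -> x \in C -> x \notin saturated ->
  exists D : sgraph T,
    [/\ subrel D G, forall z w, D z w -> z \in C,
        forall z, z \in C -> connect D z a &
        forall w, deg D w + (w == x) <= k].
Proof.
move=> k1 xC.
(* The cases differ only in the parent map. In the degree bound, [w != a] counts the edge to the
   parent and [w == x] the free slot. *)
suff build p' : (forall z, z \in C -> z != a -> G z (p' z)) ->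
    (forall z, z \in C -> z != a -> p' z = p z \/ p' z = a) ->
    (forall w, #|children C a p' w| + (w != a) + (w == x) <= k) ->
    exists D : sgraph T,
    [/\ subrel D G, forall z w, D z w -> z \in C,
        forall z, z \in C -> connect D z a &
        forall w, deg D w + (w == x) <= k].
  rewrite inE xC /= !negb_and negbK.
  have [xa _|xa /=] := eqVneq x a.
    apply: (build p) => [z zC za|z _ _|w]; [by case: (pC zC za)|by left|].
    have := ch_lt w; rewrite xa; case: (w == a) => /=; lia.
  have [fx|nfx _] := eqVneq #|children C a p x| k.-1; last first.
    apply: (build p) => [z zC za|z _ _|w]; [by case: (pC zC za)|by left|].
    have := ch_lt w; case: (eqVneq w x) => [->|_]; last by case: (w == a) => /=; lia.
    rewrite xa; move: nfx => /=; lia.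
  rewrite negb_forall_in /= => /exists_inP[c].
  rewrite inE => /and3P[cC ca /eqP pcx]; rewrite negbK => Gac.
  pose p' z := if z == c then a else p z.
  apply: (build p') => [z zC za|z _ _|w].
  - by rewrite /p'; case: eqP => [->|_]; [rewrite adj_sym|case: (pC zC za)].
  - by rewrite /p'; case: eqP; [right|left].
  (* The root has no parent edge, so it can take [c] even if it already has [k - 1] children. *)
  have sub : children C a p' w \subset
      (if w == a then c |: children C a p w else
       if w == x then children C a p w :\ c else children C a p w).
    apply/subsetP => z; rewrite !inE /p' => /and3P[zC za].
    case: (eqVneq z c) => [->|zc] /eqP <-; first by rewrite eqxx !inE eqxx.
    have h : z \in children C a p (p z) by rewrite inE zC za eqxx.
    by case: (p z == a); [|case: (p z == x)]; rewrite ?in_setU1 ?in_setD1 ?h ?zc ?orbT.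
  move/subset_leq_card: sub; have := ch_lt w.
  have [->|wa] := eqVneq w a.
    by rewrite eq_sym (negbTE xa) cardsU1 /=; case: (_ \notin _) => /=; lia.
  have [->|wx] := eqVneq w x => /=; last by lia.
  have cx : c \in children C a p x by rewrite inE cC ca pcx eqxx.
  by rewrite (cardsD1 c (children _ _ _ x)) cx /=; lia.
move=> Gp' p'p degp'; exists (parent_graph C a p'); split.
- move=> z w /andP[_ /orP[]/and3P[zC za /eqP <-]]; first exact: Gp'.
  by rewrite adj_sym; apply: Gp'.
- move=> z w /andP[_ /orP[/and3P[//]|/and3P[wC wa /eqP <-]]].
  by case: (p'p w wC wa) => ->; [case: (pC wC wa)|].
- move=> z zC; apply: (connect_parent_graph (d := d)) => // y yC ya.
  by case: (p'p y yC ya) => ->; [case: (pC yC ya) => ? _ ?; split; [|right]|split; [|left]].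
- move=> w; apply: leq_trans (degp' w); rewrite leq_add2r.
  apply: leq_trans (deg_parent_graph _ _ _ w) _; rewrite leq_add2l.
  by case: (w \in C).
Qed.

End Branch.

(** * Adding an edge, and the closure inequality *)

Section AddEdge.
Variables (T : finType) (G : sgraph T) (u v : T).

Definition add_edge_rel : rel T := fun x y =>
  G x y || (x != y) && ([&& x == u & y == v] || [&& x == v & y == u]).

Lemma add_edge_sym : symmetric add_edge_rel.
Proof.
move=> x y; rewrite /add_edge_rel adj_sym eq_sym orbC [RHS]orbC.
by rewrite [_ || (_ && (y == u))]orbC ![(y == _) && _]andbC.
Qed.

Lemma add_edge_irr : irreflexive add_edge_rel.
Proof. by move=> x; rewrite /add_edge_rel adj_irr eqxx. Qed.

Definition add_edge : sgraph T := SGraph add_edge_sym add_edge_irr.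

End AddEdge.

(** The edge from [x] to [y] joins the two connected pieces, and the slots reserved at its ends
    absorb it in the degree bound. *)
Lemma connected_glue k (T : finType) (G D1 D2 : sgraph T) (C : {set T}) a b x y :
  subrel D1 G -> subrel D2 G -> G x y ->
  (forall z w, D1 z w -> z \in C) -> (forall z w, D2 z w -> z \in ~: C) ->
  (forall z, z \in C -> connect D1 z a) ->
  (forall z, z \in ~: C -> connect D2 z b) ->
  x \in C -> y \in ~: C ->
  (forall w, deg D1 w + (w == x) <= k) -> (forall w, deg D2 w + (w == y) <= k) ->
  has_connected_kgraph k G.
Proof.
move=> s1 s2 Gxy C1 C2 c1 c2 xC yC d1 d2.
have xy : x != y by apply: contraTneq yC => <-; rewrite inE xC.
pose e : rel T := fun z w =>
  [|| D1 z w, D2 z w, (z == x) && (w == y) | (z == y) && (w == x)].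
have e_sym : symmetric e.
  move=> z w; rewrite /e adj_sym [D2 z w]adj_sym; do 2 congr (_ || _).
  by rewrite orbC; congr (_ || _); rewrite andbC.
have e_irr : irreflexive e.
  move=> z; rewrite /e !adj_irr /= andbC orbb.
  by case: (eqVneq z y) => // ->; rewrite eq_sym (negbTE xy).
pose F := SGraph e_sym e_irr; exists F.
have eE z w :
  F z w = [|| D1 z w, D2 z w, (z == x) && (w == y) | (z == y) && (w == x)] by [].
split.
- move=> z w; rewrite eE => /or4P[/s1|/s2|/andP[/eqP-> /eqP->]|/andP[/eqP-> /eqP->]] //.
  by rewrite adj_sym.
- split; first by apply/card_gt0P; exists x.
  have toa z : connect F z x.
    have in1 z1 z2 : connect D1 z1 z2 -> connect F z1 z2.
      by apply: connect_sub => ? ? h; apply: connect1; rewrite eE h.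
    have in2 z1 z2 : connect D2 z1 z2 -> connect F z1 z2.
      by apply: connect_sub => ? ? h; apply: connect1; rewrite eE h orbT.
    have [zC|] := boolP (z \in C).
      by apply: connect_trans (in1 _ _ (c1 _ zC)) _; rewrite connect_symG in1 ?c1.
    rewrite -in_setC => zC; apply: connect_trans (in2 _ _ (c2 _ zC)) _.
    apply: (@connect_trans _ _ y); first by rewrite connect_symG in2 ?c2.
    by apply: connect1; rewrite eE !eqxx !orbT.
  by move=> z w; apply: connect_trans (toa z) _; rewrite connect_symG.
move=> w; have [wC|] := boolP (w \in C).
  apply: leq_trans (d1 w).
  apply: (@leq_trans #|[set z | D1 w z] :|: (if w == x then [set y] else set0)|).
    apply/subset_leq_card/subsetP => z; rewrite !inE eE => /or4P[->//|/C2||].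
    - by rewrite inE wC.
    - by case/andP => -> /eqP->; rewrite inE eqxx orbT.
    - by case/andP=> /eqP ew; rewrite ew in wC; rewrite inE wC in yC.
  apply: leq_trans (leq_card_setU _ _).1 _; rewrite leq_add2l.
  by case: (w == x); rewrite ?cards1 ?cards0.
move=> wC; apply: leq_trans (d2 w).
apply: (@leq_trans #|[set z | D2 w z] :|: (if w == y then [set x] else set0)|).
  apply/subset_leq_card/subsetP => z; rewrite !inE eE => /or4P[/C1|->//||].
  - by rewrite (negbTE wC).
  - by case/andP=> /eqP ew; rewrite ew xC in wC.
  - by case/andP => -> /eqP->; rewrite inE eqxx orbT.
apply: leq_trans (leq_card_setU _ _).1 _; rewrite leq_add2l.
by case: (w == y); rewrite ?cards1 ?cards0.
Qed.

(** After removal of [S] no edge leaves the rest of [C], while [u] and [v] survive on opposite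
    sides; so [S] is a separator. *)
Lemma t_connected_cut t (T : finType) (G : sgraph T) (C S : {set T}) u v :
  t_connected t G -> u \in C :\: S -> v \in ~: C :\: S ->
  (forall x y, x \in C -> y \in ~: C -> G x y -> (x \in S) || (y \in S)) ->
  t <= #|S|.
Proof.
case=> _ tG; rewrite !inE => /andP[uS uC] /andP[vS vC] cut.
rewrite leqNgt; apply/negP => /tG[_ connS].
have uS' : u \in ~: S by rewrite inE.
have vS' : v \in ~: S by rewrite inE.
pose I := induced G (~: S).
have cl : closed I [pred z | val z \in C].
  apply: intro_closed; first by apply: sym_connect_sym; apply: adj_sym.
  move=> [x xS] [y yS] Ixy /= xC; apply/negPn/negP => yC.
  have := cut x y xC; rewrite inE yC => /(_ isT Ixy).
  by move: (xS) (yS); rewrite !inE => /negbTE-> /negbTE->.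
have := closed_connect cl (connS (exist _ u uS') (exist _ v vS')).
by rewrite !inE /= uC (negbTE vC).
Qed.

Lemma add_edge_kgraph_closure k t (T : finType) (G : sgraph T) u v :
  1 < k -> t_connected t G -> u != v ->
  has_connected_kgraph k (add_edge G u v) -> ~ has_connected_kgraph k G ->
  deg G u + deg G v + (k - 2) * t + 2 <= #|T|.
Proof.
move=> k1 tG uv [F [sF connF degF]] noG.
have [d [p Hp]] := distance_parent u connF.
(* Only the step from [v] to its parent [u] can use the added edge. *)
have Gp z : z != u -> (z != v) || (p z != u) -> G z (p z).
  move=> zu zv; have [/sF /orP[//|]] := Hp z zu.
  rewrite (negbTE zu) /= => /andP[_ /andP[/eqP ez /eqP epz]].
  by move: zv; rewrite epz ez !eqxx.
(* Otherwise the whole breadth-first tree lies in [G]. *)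
have pv : p v = u.
  apply/eqP/negPn/negP => npv; case: noG.
  exists (parent_graph [set: T] u p); split.
  - have Gp' z : z != u -> G z (p z).
      by move=> zu; apply: Gp => //; case: (eqVneq z v) => //= ->.
    move=> x y /andP[_ /orP[]/and3P[_ /Gp' Gx /eqP <-] //]; by rewrite adj_sym.
  - split; first by apply/card_gt0P; exists u.
    have toR z : connect (parent_graph [set: T] u p) z u.
      apply: (connect_parent_graph (d := d)); last by rewrite inE.
      by move=> w _ /Hp[_ dw]; rewrite inE; split=> //; right.
    by move=> x y; apply: connect_trans (toR x) _; rewrite connect_symG.
  - move=> x; apply: leq_trans (degF x); apply/subset_leq_card/subsetP => y.
    rewrite !inE => /andP[_ /orP[]/and3P[_ /Hp[Fx _] /eqP <-] //].
    by rewrite adj_sym.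
(* With [u] and [v] made fixed points, iterating the parent map reaches one of them, and the maximum
   of [d] is enough iterations. *)
pose q z := if (z == u) || (z == v) then z else p z.
pose rt := iter (\max_z d z) q.
have qu : q u = u by rewrite /q eqxx.
have qv : q v = v by rewrite /q eqxx orbT.
have rtuv z : rt z = u \/ rt z = v.
  rewrite /rt; have : d z <= \max_z d z by exact: leq_bigmax.
  elim: (\max_z d z) z => [|m IH] z dz.
    left; apply/eqP/negPn/negP => /Hp[_].
    by move: dz; rewrite leqn0 => /eqP ->.
  rewrite iterSr; have [zu|zu] := eqVneq z u.
    by left; rewrite zu qu iter_fix.
  have [zv|zv] := eqVneq z v; first by right; rewrite zv qv iter_fix.
  apply: IH; rewrite /q (negbTE zu) (negbTE zv) /=.
  by rewrite -ltnS; apply: leq_trans dz; case: (Hp z zu).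
have rtu : rt u = u by rewrite /rt iter_fix.
have rtv : rt v = v by rewrite /rt iter_fix.
have rtp z : z != u -> z != v -> rt (p z) = rt z.
  move=> zu zv; have -> : p z = q z by rewrite /q (negbTE zu) (negbTE zv).
  rewrite /rt -iterSr iterS -/(rt z).
  by case: (rtuv z) => ->; rewrite ?qu ?qv.
pose C := [set z | rt z == u].
have CcE z : (z \in ~: C) = (rt z == v).
  rewrite !inE; case: (rtuv z) => ->; rewrite eqxx ?(negbTE uv) //.
  by rewrite eq_sym uv.
have branch a (B : {set T}) : a \in [set u; v] -> B =i [set z | rt z == a] ->
  [/\ a \in B, forall z, z \in B -> z != a ->
        [/\ p z \in B, G z (p z) & d (p z) < d z] &
      forall x, #|children B a p x| < k].
  move=> auv BE.
  have rta : rt a = a by move: auv; rewrite !inE => /orP[]/eqP->.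
  have Bnuv z : z \in B -> z != a -> (z != u) && (z != v).
    rewrite BE inE => /eqP rz za.
    by apply/andP; split; apply: contraNneq za => ez; rewrite -rz ez ?rtu ?rtv.
  split; first by rewrite BE inE rta.
    move=> z zB za; have /andP[zu zv] := Bnuv z zB za.
    split; last by case: (Hp z zu).
      by rewrite BE inE rtp //; move: zB; rewrite BE inE.
    by apply: Gp => //; rewrite zv.
  move=> x; apply: leq_trans (degF x).
  (* [P] is a neighbour of [x] in [F] that is not a child in the branch: the parent of [x], or [v]
     when [x] is [u]. This leaves room for fewer than [k] children. *)
  pose P := if x == u then v else p x.
  have ch z : z \in children B a p x -> [/\ z != u, z != v & p z = x].
    by rewrite inE => /and3P[zB /(Bnuv z zB)/andP[-> ->] /eqP].
  suff : P |: children B a p x \subset [set y | F x y].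
    move/subset_leq_card; rewrite cardsU1 /deg.
    suff -> : P \notin children B a p x by [].
    apply/negP => /ch; rewrite /P; case: (eqVneq x u) => [_|xu] [Pu Pv pP].
      by rewrite eqxx in Pv.
    have [_] := Hp _ xu; have [_] := Hp _ Pu; rewrite pP.
    by move=> l1 l2; have := ltn_trans l1 l2; rewrite ltnn.
  apply/subsetP => y; rewrite !inE => /orP[/eqP->|].
    rewrite /P; case: (eqVneq x u) => [->|xu]; last by case: (Hp x xu).
    by rewrite adj_sym -pv; case: (Hp v _); rewrite // eq_sym.
  move/andP=> [yB /andP[ya yx]]; have [|yu _ <-] := ch y; first by rewrite inE yB ya.
  by rewrite adj_sym; case: (Hp y yu).
have [uC pCu chu] := branch u C (set21 u v) (fun _ => erefl).
have [vC pCv chv] : [/\ v \in ~: C, forall z, z \in ~: C -> z != v ->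
        [/\ p z \in ~: C, G z (p z) & d (p z) < d z] &
      forall x, #|children (~: C) v p x| < k].
  by apply: branch; [exact: set22 | move=> z; rewrite CcE inE].
pose Su := saturated k G C u p; pose Sv := saturated k G (~: C) v p.
have cardu := card_saturated_lt k G p uC.
have cardv := card_saturated_lt k G p vC.
(* An edge between two unsaturated vertices would glue the rearranged branches inside [G]. *)
have cross x y : x \in C -> y \in ~: C -> G x y -> (x \in Su) || (y \in Sv).
  move=> xC yC Gxy; apply/negPn/negP; rewrite negb_or => /andP[xS yS].
  have [D1 [s1 C1 c1 d1]] := unsaturated_branch uC pCu chu k1 xC xS.
  have [D2 [s2 C2 c2 d2]] := unsaturated_branch vC pCv chv k1 yC yS.
  by apply: noG; apply: (connected_glue s1 s2 Gxy C1 C2 c1 c2 xC yC).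
have uSu : u \notin Su by rewrite inE eqxx andbF.
have vSv : v \notin Sv by rewrite inE eqxx andbF.
have SuC x : x \in Su -> x \in C by rewrite inE => /andP[].
have SvC x : x \in Sv -> x \in ~: C by rewrite inE => /andP[].
(* The saturated vertices thus form a cut; the roots are never saturated, so a vertex survives on
   each side. *)
have tS : t <= #|Su| + #|Sv|.
  rewrite -cardsUI; apply: leq_trans (leq_addr _ _).
  apply: (t_connected_cut (C := C) (u := u) (v := v) tG).
  - rewrite in_setD uC andbT in_setU (negbTE uSu) /=.
    by apply/negP => /SvC; rewrite inE uC.
  - rewrite in_setD vC andbT in_setU (negbTE vSv) orbF.
    by apply/negP => /SuC; move: vC; rewrite inE => /negP.
  - move=> x y xC yC Gxy; have := cross x y xC yC Gxy; rewrite !in_setU.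
    by case/orP => ->; rewrite ?orbT.
(* Since [u] is unsaturated, all its neighbours in the branch of [v] are saturated. *)
have degu : deg G u <= #|[set y in C | G u y]| + #|Sv|.
  rewrite -cardsUI; apply: leq_trans (leq_addr _ _).
  apply/subset_leq_card/subsetP => y; rewrite inE => Guy.
  rewrite in_setU [X in X || _]inE Guy andbT; have [//|yC] := boolP (y \in C).
  by have := cross u y uC; rewrite in_setC yC Guy (negbTE uSu) => ->.
have degv : deg G v <= #|[set y in ~: C | G v y]| + #|Su|.
  rewrite -cardsUI; apply: leq_trans (leq_addr _ _).
  apply/subset_leq_card/subsetP => y; rewrite inE => Gvy.
  rewrite in_setU [X in X || _]inE in_setC Gvy andbT; have [yC|//] := boolP (y \in C).
  by have := cross y v yC vC; rewrite adj_sym Gvy (negbTE vSv) orbF => ->.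
have := cardsC C; move: cardu cardv; rewrite -/Su -/Sv.
(* Of the [k - 1] children of each saturated vertex, one offsets its possible adjacency to the
   opposite root; the other [k - 2] give the term in [t]. *)
have -> : k.-1 = (k - 2).+1 by lia.
have := leq_mul (leqnn (k - 2)) tS.
rewrite !mulSn mulnDr; lia.
Qed.

(** * Quadratic forms and the signless Laplacian *)

Section Spectral.

Local Open Scope ring_scope.
Local Open Scope sesquilinear_scope.

(** The complexification [B] is Hermitian, so its eigenvalues are real and are eigenvalues of [A].
    In the coordinates [Y] of [x] in a unitary eigenbasis, both forms become weighted sums of
    squared moduli. *)
Lemma symmetric_quadratic_le (R : rcfType) n (A : 'M[R]_n) (c : R) (x : 'rV_n) :
  A^T = A -> (forall a, eigenvalue A a -> a <= c) ->
  (x *m A *m x^T) 0 0 <= c * (x *m x^T) 0 0.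
Proof.
move=> symA eigA.
pose f : {rmorphism R -> R[i]} := real_complex R.
pose B := map_mx f A; pose X := map_mx f x.
have freal (a : R) : f a \is Num.real by apply/complex_realP; exists a.
have hB : B \is hermsymmx.
  apply: realsym_hermsym; last by apply/mxOverP => i j; rewrite mxE freal.
  apply/is_hermitianmxP; rewrite expr0 scale1r map_mx_id // /B map_trmx symA.
  by [].
have/orthomx_spectralP := hermitian_normalmx hB.
set P := spectralmx B; set sp := spectral_diag B => defB.
have uP : P \is unitarymx := spectral_unitarymx B.
have sp_real := hermitian_spectral_diag_real hB.
have sp_le i : sp 0 i <= f c.
  have := mxOverP sp_real 0 i; rewrite -/sp => /complex_realP[r spr].
  rewrite spr lecR; apply: eigA.
  (* Eigenvalues pass from [B] to [A] through the characteristic polynomial. Row [i] of [P] is the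
     eigenvector, nonzero since [P] is unitary. *)
  rewrite eigenvalue_root_char -(fmorph_root f) map_char_poly -/B.
  rewrite -eigenvalue_root_char; apply/eigenvalueP; exists (row i P).
    rewrite {1}defB !mulmxA -row_mul mulmxV ?spectral_unit //.
    by rewrite -row_mul mul1mx row_diag_mx -scalemxAl -rowE spr.
  apply/negP => /eqP rP0.
  have := congr1 (fun M : 'M_n => M i i) (unitarymxP uP).
  rewrite !mxE eqxx => /eqP; rewrite big1 ?(eq_sym 0) ?oner_eq0 // => j _.
  by have := congr1 (fun M : 'rV_n => M 0 j) rP0; rewrite !mxE => ->; rewrite mul0r.
pose Y := X *m P ^t*.
have XT : X^T = X^t* .
  apply/matrixP => i j; rewrite !mxE.
  by have /CrealP -> := freal (x j i).
have eq1 : f ((x *m A *m x^T) 0 0) = \sum_i sp 0 i * `|Y 0 i| ^+ 2.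
  have -> : f ((x *m A *m x^T) 0 0) = (X *m B *m X^T) 0 0.
    by rewrite /X /B map_trmx -!map_mxM [RHS]mxE.
  rewrite defB (invmx_unitary uP) !mulmxA -/Y XT.
  have -> : Y *m diag_mx sp *m P *m X ^t* = Y *m diag_mx sp *m Y ^t*.
    by rewrite -mulmxA /Y trmx_mul map_mxM trmxCK.
  rewrite mul_mx_diag !mxE; apply: eq_bigr => i _.
  by rewrite !mxE normCK; ring.
have eq2 : f ((x *m x^T) 0 0) = \sum_i `|Y 0 i| ^+ 2.
  have -> : f ((x *m x^T) 0 0) = (X *m X^T) 0 0.
    by rewrite /X map_trmx -!map_mxM [RHS]mxE.
  have -> : X *m X^T = Y *m Y ^t*.
    rewrite XT /Y trmx_mul map_mxM trmxCK mulmxA -(invmx_unitary uP).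
    by rewrite mulmxKV // spectral_unit.
  by rewrite mxE; apply: eq_bigr => i _; rewrite !mxE normCK.
rewrite -lecR -/(f _) -/(f (c * _)) rmorphM eq1 eq2 mulr_sumr.
by apply: ler_sum => i _; rewrite ler_wpM2r ?exprn_ge0.
Qed.

Lemma sum_adj_l (T : finType) (G : sgraph T) (f : T -> nat) :
  (\sum_u \sum_v G u v * f u = \sum_u deg G u * f u)%N.
Proof.
apply: eq_bigr => u _; rewrite -big_distrl /= /deg; congr (_ * _)%N.
by rewrite -sum1dep_card [RHS]big_mkcond; apply: eq_bigr => v _; case: (G u v).
Qed.

Lemma sum_adj_r (T : finType) (G : sgraph T) (f : T -> nat) :
  (\sum_u \sum_v G u v * f v = \sum_u deg G u * f u)%N.
Proof.
rewrite exchange_big -sum_adj_l; apply: eq_bigr => u _; apply: eq_bigr => v _.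
by rewrite adj_sym.
Qed.

(** Summing over ordered pairs counts each edge twice, so the left side is twice the quadratic form
    at [f]; hence the factor 2 on the right. *)
Lemma signless_laplacian_quadratic_le (R : realType) (T : finType)
    (G : sgraph T) (c : nat) (f : T -> nat) :
  (forall a, eigenvalue (signless_laplacian R G) a -> a <= c%:R) ->
  (\sum_u \sum_v G u v * (f u + f v) ^ 2 <= c * \sum_u 2 * f u ^ 2)%N.
Proof.
set Q := signless_laplacian R G => eigQ.
have QT : Q^T = Q.
  rewrite /Q /signless_laplacian linearD /= tr_diag_mx; congr (_ + _).
  by apply/matrixP => i j; rewrite !mxE adj_sym.
pose x := \row_i (f (enum_val i))%:R : 'rV[R]_#|T|.
have := symmetric_quadratic_le x QT eigQ.
have bij : {on [pred _ | true], bijective (@enum_val T T)}.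
  exact: onW_bij (enum_val_bij T).
have -> : (x *m x^T) 0 0 = (\sum_u f u ^ 2)%:R.
  rewrite mxE natr_sum (reindex _ bij); apply: eq_bigr => i _.
  by rewrite !mxE natrX.
have -> : (x *m Q *m x^T) 0 0 =
    (\sum_u deg G u * f u ^ 2 + \sum_u \sum_v G u v * (f u * f v))%:R.
  rewrite /Q /signless_laplacian mulmxDr mulmxDl mxE natrD; congr (_ + _).
    rewrite mxE natr_sum (reindex _ bij); apply: eq_bigr => i _.
    by rewrite mul_mx_diag !mxE natrM natrX; ring.
  rewrite exchange_big mxE natr_sum (reindex _ bij); apply: eq_bigr => i _.
  rewrite mxE natr_sum (reindex _ bij) mulr_suml; apply: eq_bigr => j _.
  by rewrite !mxE !natrM; ring.
rewrite -natrM ler_nat => le_c.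
rewrite -big_distrr /= mulnCA.
apply: leq_trans (leq_mul (leqnn 2) le_c).
rewrite mulnDr {1}mul2n -addnn -{1}sum_adj_l -sum_adj_r big_distrr /= -!big_split /=.
apply/eq_leq/eq_bigr => u _; rewrite big_distrr /= -!big_split.
by apply: eq_bigr => v _ /=; ring.
Qed.

(* The test vector is the degree vector of [H], that is the image of the
   all-ones vector on the edges of [H] under the incidence matrix. *)
Lemma signless_laplacian_edge_degrees (R : realType) (T : finType)
    (G H : sgraph T) (c : nat) :
  subrel H G ->
  (forall a, eigenvalue (signless_laplacian R G) a -> a <= c%:R) ->
  (forall u v, H u v -> (c <= deg H u + deg H v)%N) ->
  forall u v, G u v -> (deg H u + deg H v = H u v * c)%N.
Proof.
move=> sHG eigG edgeH.
have := signless_laplacian_quadratic_le (deg H) eigG.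
(* Written as a sum over edges of [H], the sum of squared degrees can be compared with the other
   side pair by pair. *)
have -> : (c * \sum_u 2 * deg H u ^ 2 =
    \sum_u \sum_v c * (H u v * (deg H u + deg H v)))%N.
  under [RHS]eq_bigr do rewrite -big_distrr /=.
  rewrite -[RHS]big_distrr /=. congr (_ * _)%N.
  under [RHS]eq_bigr do under eq_bigr do rewrite mulnDr.
  under [RHS]eq_bigr do rewrite big_split /=.
  rewrite [RHS]big_split /= sum_adj_l sum_adj_r -big_distrr /= mul2n -addnn.
  by congr addn; apply: eq_bigr => u _; rewrite -mulnn.
(* Each pair satisfies the inequality opposite to the spectral bound on the sums, so equality holds
   at every pair. A pair adjacent in [G] but not in [H] must then have degree sum 0. *)
pose C p := (c * (H p.1 p.2 * (deg H p.1 + deg H p.2)) ==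
                G p.1 p.2 * (deg H p.1 + deg H p.2) ^ 2)%N.
have le p : (c * (H p.1 p.2 * (deg H p.1 + deg H p.2)) <=
                G p.1 p.2 * (deg H p.1 + deg H p.2) ^ 2 ?= iff C p)%N.
  split=> //; case Huv: (H _ _); rewrite ?muln0 // (sHG _ _ Huv) !mul1n -mulnn.
  by rewrite leq_mul2r edgeH ?orbT.
rewrite !pair_big /= => le1.
have [le2 eqC] := leqif_sum (P := xpredT) (fun p _ => le p).
have /forall_inP allC : [forall (p | true), C p].
  by rewrite -eqC eqn_leq le2.
move=> u v Guv; have /eqP := allC (u, v) isT.
rewrite /= Guv mul1n -mulnn; case Huv: (H u v); rewrite /= ?mul1n ?mul0n.
  have := edgeH _ _ Huv; move: (deg H u + deg H v)%N => s le_cs /eqP.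
  by rewrite eqn_mul2r => /orP[/eqP s0 | /eqP->//]; move: le_cs; rewrite s0 leqn0 => /eqP.
by rewrite muln0 => /esym/eqP; rewrite muln_eq0 orbb => /eqP.
Qed.

End Spectral.

(** * Edge-maximal graphs and the extremal family *)

Lemma complete_connected_kgraph k (T : finType) (G : sgraph T) (x0 : T) :
  1 < k -> (forall x y, x != y -> G x y) -> has_connected_kgraph k G.
Proof.
move=> k1 complG.
pose d x := index x (enum T).
have dlt x : d x < size (enum T) by rewrite index_mem mem_enum.
pose at_ i := nth x0 (enum T) i.
have dK x : at_ (d x) = x by rewrite /at_ nth_index // mem_enum.
have Kd i : i < size (enum T) -> d (at_ i) = i.
  by move=> ilt; rewrite /d index_uniq ?enum_uniq.
(* The enumeration order gives a Hamiltonian path, in which the parent of a vertex is its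
   predecessor. *)
pose r := at_ 0; pose p x := at_ (d x).-1.
have d0 x : x != r -> 0 < d x.
  by apply: contraNltn; rewrite leqn0 => /eqP dx; rewrite -(dK x) dx.
have dp x : x != r -> d (p x) = (d x).-1.
  by move=> xr; rewrite Kd //; apply: leq_ltn_trans (leq_pred _) (dlt x).
exists (parent_graph [set: T] r p); split.
- by move=> x y /andP[xy _]; apply: complG.
- split; first by apply/card_gt0P; exists x0.
  have toR z : connect (parent_graph [set: T] r p) z r.
    apply: (connect_parent_graph (d := d)); last by rewrite inE.
    move=> w _ wr; rewrite inE; split=> //; right.
    by rewrite dp // prednK ?d0.
  by move=> x y; apply: connect_trans (toR x) _; rewrite connect_symG.
- move=> x; apply: leq_trans k1; apply: leq_trans (deg_parent_graph _ _ _ x) _.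
  apply: (@leq_add _ _ 1 1); last exact: leq_b1.
  (* The only possible child is the successor. At the last index the default [x0] appears,
     harmlessly, since only an upper bound is sought. *)
  rewrite -(cards1 (at_ (d x).+1)); apply/subset_leq_card/subsetP => z.
  rewrite !inE /= => /andP[zr /eqP <-].
  by rewrite dp // prednK ?d0 // dK.
Qed.

Lemma maximal_without_connected_kgraph k (T : finType) (G : sgraph T) :
  ~ has_connected_kgraph k G ->
  exists G' : sgraph T, [/\ subrel G G', ~ has_connected_kgraph k G' &
    forall u v, u != v -> ~~ G' u v -> has_connected_kgraph k (add_edge G' u v)].
Proof.
pose nonedges (G : sgraph T) := [set e : T * T | ~~ G e.1 e.2].
have [m] := ubnP #|nonedges G|; elim: m G => // m IH G; rewrite ltnS => le_m noG.
have [[u [v [uv Guv no]]]|max] := pselect (exists u v,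
  [/\ u != v, ~~ G u v & ~ has_connected_kgraph k (add_edge G u v)]); last first.
  exists G; split=> // u v uv Guv; apply: contrapT => no; apply: max.
  by exists u, v.
have [] := IH (add_edge G u v) _ no.
  apply: leq_trans le_m; apply: proper_card; apply/properP; split.
    apply/subsetP => e; rewrite !inE; apply: contra => Ge.
    by rewrite /= /add_edge_rel Ge.
  exists (u, v); rewrite !inE //=.
  by rewrite /add_edge_rel uv !eqxx orbT.
move=> G' [sG' noG' maxG']; exists G'; split=> // x y Gxy; apply: sG'.
by rewrite /= /add_edge_rel Gxy.
Qed.

Lemma t_connected_subrel t (T : finType) (G G' : sgraph T) :
  subrel G G' -> t_connected t G -> t_connected t G'.
Proof.
move=> sG [tT tG]; split=> // S /tG[ne conn]; split=> // x y.
apply: connect_sub (conn x y) => z w zw; apply: connect1; exact: sG.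
Qed.

Lemma deg_compl (T : finType) (G : sgraph T) x :
  deg G x + deg (compl G) x + 1 = #|T|.
Proof.
have := cardsC [set y | G x y]; rewrite /deg => <-.
rewrite (cardsD1 x (~: _)) !inE adj_irr /= addnA addnAC; congr (_ + _ + _).
by apply: eq_card => y; rewrite !inE /= /compl_rel eq_sym.
Qed.

(* Otherwise [H] contains a spanning complete bipartite graph, by counting the
   vertices of the two degrees. *)
Lemma edge_regular_regular t c (T : finType) (G H : sgraph T) u :
  0 < t -> t_connected t G -> subrel H (compl G) -> #|T| <= c ->
  (forall x y, H x y -> deg H x + deg H y = c) ->
  0 < deg H u -> (deg H u).*2 = c.
Proof.
move=> t0 tG sH le_c edgeH /card_gt0P[v]; rewrite inE => Huv.
have degc := edgeH _ _ Huv.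
have [eab|nab] := eqVneq (deg H u) (deg H v); first by rewrite -addnn {2}eab.
pose A := [set x | deg H x == deg H u]; pose B := [set x | deg H x == deg H v].
have NA x : x \in A -> [set y | H x y] \subset B.
  rewrite inE => /eqP dx; apply/subsetP => y; rewrite !inE => /edgeH.
  by rewrite dx -degc => /addnI ->.
have NB x : x \in B -> [set y | H x y] \subset A.
  rewrite inE => /eqP dx; apply/subsetP => y; rewrite !inE => /edgeH.
  by rewrite dx -degc addnC => /addIn ->.
have uA : u \in A by rewrite inE.
have vB : v \in B by rewrite inE.
have AB : A \subset ~: B.
  by apply/subsetP => x; rewrite !inE => /eqP ->.
have leB := subset_leq_card (NA u uA); have leA := subset_leq_card (NB v vB).
have leAB := subset_leq_card AB; have cB := cardsC B.
(* Here [deg H u <= #|B|], [deg H v <= #|A|] and [#|A| + #|B| <= #|T| <= c]; as the two degrees sum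
   to [c], all are equalities. *)
have eB : #|B| = deg H u by rewrite /deg in leB leA degc *; lia.
have eA : A = ~: B.
  by apply/eqP; rewrite eqEcard AB /=; rewrite /deg in leB leA degc *; lia.
(* In [H] every vertex of [A] is adjacent to all of [B], so no edge of [G] crosses and the empty set
   is a cut. *)
suff : t <= #|(set0 : {set T})| by rewrite cards0 leqNgt t0.
apply: (t_connected_cut (C := A) (u := u) (v := v) tG).
- by rewrite setD0.
- by rewrite setD0 eA setCK.
- move=> x y xA; rewrite eA setCK => yB Gxy.
  have /eqP NxB : [set z | H x z] == B.
    by rewrite eqEcard NA //= eB; move: xA; rewrite inE => /eqP <-.
  by move: yB; rewrite -NxB inE => /sH /=; rewrite /compl_rel Gxy andbF.
Qed.

Lemma join_regular_isomorphic (T : finType) (G : sgraph T) (C : {set T}) s :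
  (forall x y, x \notin C -> y \in C -> G x y) ->
  (forall x, x \in C -> #|[set y in C | G x y]| = s) ->
  exists (Gr : sgraph 'I_#|~: C|) (H : sgraph 'I_(#|T| - #|~: C|)),
    regular H s /\ isomorphic G (join Gr H).
Proof.
move=> cross regC.
(* The index set of the regular factor has the form [n - r] used in [in_G3]; a cast identifies it
   with [C]. *)
have E : #|T| - #|~: C| = #|C| by rewrite -(cardsC C) addnK.
pose e1 (i : 'I_#|~: C|) : T := enum_val i.
pose e2 (i : 'I_(#|T| - #|~: C|)) : T := enum_val (cast_ord E i).
have e1C i : e1 i \notin C by have := enum_valP i; rewrite inE.
have e2C i : e2 i \in C by exact: enum_valP.
have e1inj : injective e1 by exact: enum_val_inj.
have e2inj : injective e2 by move=> i j /enum_val_inj/cast_ord_inj.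
have sym1 : symmetric (fun i j => G (e1 i) (e1 j)) by move=> i j; rewrite adj_sym.
have irr1 : irreflexive (fun i j => G (e1 i) (e1 j)) by move=> i; rewrite adj_irr.
have sym2 : symmetric (fun i j => G (e2 i) (e2 j)) by move=> i j; rewrite adj_sym.
have irr2 : irreflexive (fun i j => G (e2 i) (e2 j)) by move=> i; rewrite adj_irr.
exists (SGraph sym1 irr1), (SGraph sym2 irr2); split.
  move=> i; rewrite -(regC _ (e2C i)) /deg -(card_imset _ e2inj).
  apply: eq_card => y; rewrite inE; apply/imsetP/andP.
    by case=> j; rewrite inE => Gij ->.
  case=> yC Gy; pose j := cast_ord (esym E) (enum_rank_in yC y).
  have ej : e2 j = y by rewrite /e2 cast_ordKV enum_rankK_in.
  by exists j => //; rewrite inE /= ej.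
pose g (z : 'I_#|~: C| + 'I_(#|T| - #|~: C|)) :=
  match z with inl i => e1 i | inr i => e2 i end.
have ginj : injective g.
  move=> [i|i] [j|j] /= eij; first by rewrite (e1inj _ _ eij).
  - by have := e1C i; rewrite eij e2C.
  - by have := e1C j; rewrite -eij e2C.
  - by rewrite (e2inj _ _ eij).
have [|f gK fK] := inj_card_bij ginj.
  by rewrite card_sum !card_ord subnKC // max_card.
exists f; first by exists g.
move=> x y; rewrite -{2}(fK x) -{2}(fK y); case: (f x) (f y) => [i|i] [j|j] //=.
  by rewrite cross.
by rewrite adj_sym cross.
Qed.

Lemma no_connected_kgraph_in_G3 (R : realType) (n k t : nat) (T : finType) (G : sgraph T) :
  1 < k -> 0 < t -> #|T| = n -> t_connected t G ->
  (forall a, eigenvalue (signless_laplacian R (compl G)) a ->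
     (a <= (n + (k - 2) * t)%:R)%R) ->
  ~ has_connected_kgraph k G -> in_G3 n k t G.
Proof.
move=> k1 t0 Tn tG eigG noG.
have [G' [sG noG' maxG']] := maximal_without_connected_kgraph noG.
have tG' := t_connected_subrel sG tG.
set s := (k - 2) * t; set c := n + s.
pose H := compl G'.
have sH : subrel H (compl G).
  by move=> x y /andP[xy]; rewrite /= /compl_rel xy; apply: contra; apply: sG.
(* In the complement the closure bound becomes a lower bound, with [2(n - 1) - (n - 2 - s) = c]. *)
have edge_ge u v : H u v -> c <= deg H u + deg H v.
  move=> /andP[uv Guv].
  have := add_edge_kgraph_closure k1 tG' uv (maxG' u v uv Guv) noG'.
  have := deg_compl G' u; have := deg_compl G' v; rewrite -/H -/s Tn /c; lia.
have degK := signless_laplacian_edge_degrees sH eigG edge_ge.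
have edge_eq x y : H x y -> deg H x + deg H y = c.
  by move=> Hxy; rewrite (degK x y (sH _ _ Hxy)) Hxy mul1n.
have reg x : 0 < deg H x -> (deg H x).*2 = c.
  by apply: (edge_regular_regular t0 tG sH) => //; rewrite Tn leq_addr.
pose C := [set x | 0 < deg H x].
have HC x y : H x y -> x \in C.
  by move=> Hxy; rewrite inE; apply/card_gt0P; exists y; rewrite inE.
(* An edge of the complement of [G] outside [H] has both ends of degree 0 in [H]. Hence [G] joins
   every vertex outside [C] to all of [C]. *)
have KH x y : x != y -> ~~ G x y -> (x \in C) || (y \in C) -> H x y.
  move=> xy Gxy; apply: contraLR => nH; rewrite negb_or !inE -!eqn0Ngt.
  have := degK x y; rewrite (negbTE nH) mul0n /= /compl_rel xy Gxy => /(_ isT)/eqP.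
  by rewrite addn_eq0 => /andP[-> ->].
(* If [C] were empty, [G'] would be complete and would have a Hamiltonian path. *)
have [x0 x0C] : exists x, x \in C.
  have [x0 _] : exists x : T, x \in T.
    by apply/card_gt0P; case: tG => /(leq_ltn_trans (leq0n _)).
  apply: contrapT => noC; apply: noG'; apply: (complete_connected_kgraph x0 k1) => x y xy.
  apply/negPn/negP => Gxy; apply: noC; exists x; apply: (HC x y).
  by rewrite /= /compl_rel xy.
have cardC x : x \in C -> #|C| = #|[set y in C | G x y]| + deg H x + 1.
  move=> xC; rewrite (cardsD1 x C) xC addnC; congr addn.
  rewrite -(cardsID [set y | G x y] (C :\ x)); congr addn.
    apply: eq_card => y; rewrite !inE andbC; case Gxy: (G x y); rewrite ?andbF //= andbT.
    by rewrite (contraTneq _ Gxy) // => ->; rewrite adj_irr.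
  apply: eq_card => y; rewrite in_setD in_setD1 !in_set.
  apply/and3P/idP => [[Gxy yx yC]|Hxy].
    by apply: KH; rewrite ?xC // eq_sym.
  have /andP[xy Gxy] := Hxy; split.
  - by apply: contra Gxy; apply: sG.
  - by rewrite eq_sym.
  - by have := HC y x; rewrite adj_sym inE; apply.
have regC x : x \in C -> deg H x = deg H x0.
  move=> xC; apply: double_inj; rewrite !reg //; first by move: x0C; rewrite inE.
  by move: xC; rewrite inE.
have c0 := cardC _ x0C; have r0 : (deg H x0).*2 = c by apply: reg; move: x0C; rewrite inE.
have cC := cardsC C; rewrite Tn in cC.
(* With [d = deg H x0], this solves [n = s + 2 + 2m] given [2d = n + s]. The subtraction is not
   truncated, since [d + 1 <= #|C| <= n]; the degree inside [C] is [#|C| - d - 1 = m - #|~: C|]. *)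
pose m := deg H x0 - s.+1.
exists m, #|~: C|; split.
- by rewrite -/s /m; rewrite /c in r0; lia.
- by rewrite /m; rewrite /c in r0; lia.
rewrite -Tn; apply: join_regular_isomorphic => [x y xC yC|x xC].
  apply/negPn/negP => Gxy; have xy : x != y by apply: contraNneq xC => ->.
  by case/negP: xC; apply: (HC x y); apply: KH; rewrite ?yC ?orbT.
have := cardC _ xC; rewrite (regC x xC) /m; rewrite /c in r0; lia.
Qed.

Theorem theorem3p11 (R : realType) (n k t : nat) (T : finType) (G : sgraph T)
    (q : R) :
  (1 <= t)%N -> (2 <= k)%N ->
  #|T| = n -> t_connected t G -> ((k - 2) * t + 4 <= n)%N ->
  largest_eigenvalue (signless_laplacian R (compl G)) q ->
  (q <= (n + (k - 2) * t)%:R)%R ->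
  ~ in_G3 n k t G ->
  has_spanning_ktree k G.
Proof.
move=> t1 k2 Tn tG _ [_ q_max] le_q notG3.
apply: connected_kgraph_spanning_ktree; apply: contrapT => noF; apply: notG3.
apply: (@no_connected_kgraph_in_G3 R) k2 t1 Tn tG _ noF => a /q_max le_a.
exact: le_trans le_a le_q.
Qed.
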